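(* Let $\epsilon \in (0,1)$ and let $T = \{ \tau_1, \dots, \tau_n \}$ be a set of polygonal curves in $\mathbb{R}^d$, each of complexity at most $m$. There exists a probability distribution over linear maps $f \colon \mathbb{R}^d \to \mathbb{R}^{d'}$, where $d' \in O(\epsilon^{-2}\log (nm))$ (the hidden constant being independent of $T, n, m, d, \epsilon$), such that with high probability over the choice of $f$, the following is true for all $\sigma, \tau \in T$: (1) $\lvert d_{wF}(\sigma, \tau) - d_{wF}(F(\sigma), F(\tau)) \rvert \leq \epsilon \cdot d_{wF}(\sigma, \tau)$, and (2) $\lvert d_{F}(\sigma, \tau) - d_{F}(F(\sigma), F(\tau)) \rvert \leq \epsilon \cdot d_{F}(\sigma, \tau)$, where for any $\tau \in T$ with vertices $v^\tau_1, \dots, v^\tau_{\lvert \tau \rvert}$ we let $F(\tau)$ be the polygonal curve with vertices $f(v^\tau_1), \dots, f(v^\tau_{\lvert \tau \rvert})$.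
   Context: $\|\cdot\|$ is the Euclidean norm. A curve in $\mathbb{R}^d$ is a continuous map $\tau\colon[0,1]\to\mathbb{R}^d$. It is polygonal if there exist points $v_1,\dots,v_m\in\mathbb{R}^d$, no three consecutive on a line (the vertices of $\tau$), and instants $0=t_1<\dots<t_m=1$ such that $\tau(t_i)=v_i$ and $\tau$ connects every two consecutive vertices $v_i,v_{i+1}$ by a line segment (linear interpolation on $[t_i,t_{i+1}]$). The number $m$ is the complexity of $\tau$, denoted $|\tau|$. The image curve $F(\tau)$ is the piecewise linear curve through the listed vertices in order (the condition on collinear consecutive vertices is not required of image curves; the choice of instants does not affect the distances below). For curves $\sigma,\tau$: the weak Fréchet distance is $d_{wF}(\sigma,\tau)=\inf_{f,g}\max_{t\in[0,1]}\|\sigma(f(t))-\tau(g(t))\|$ over continuous $f,g\colon[0,1]\to[0,1]$ with $f(0)=g(0)=0$, $f(1)=g(1)=1$; the Fréchet distance $d_F(\sigma,\tau)$ is the same infimum with $f,g$ restricted to continuous bijections with $f(0)=g(0)=0$, $f(1)=g(1)=1$. ''With high probability'' has the usual meaning: for any prescribed constant $c>0$, with probability at least $1-(nm)^{-c}$, where the constant hidden in the bound on $d'$ may depend on $c$. *)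

(* Defs.v *)
(* MathComp-Analysis *)
From HB Require Import structures.
From mathcomp Require Import all_boot all_order all_algebra.
From mathcomp Require Import all_classical all_reals all_analysis.
Set Implicit Arguments.
Unset Strict Implicit.
Unset Printing Implicit Defensive.
Import Order.TTheory GRing.Theory Num.Theory.
Import numFieldNormedType.Exports.
Local Open Scope classical_set_scope.
Local Open Scope ring_scope.

(* The library norm `|v| on row vectors is the sup norm, hence this one. *)
Definition enorm {R : realType} {d : nat} (v : 'rV[R]_d) : R :=
  Num.sqrt (\sum_(i < d) v ord0 i ^+ 2).

(* A map [0,1] -> R^d is represented by a total function on R; nothing below
   depends on its values outside [0,1]. *)
Definition is_curve {R : realType} {d : nat} (tau : R -> 'rV[R]_d) : Prop :=
  {within `[0, 1]%classic, continuous tau}.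

Definition reparam {R : realType} (f : R -> R) : Prop :=
  [/\ {within `[0, 1]%classic, continuous f},
      set_fun `[0, 1]%classic `[0, 1]%classic f,
      f 0 = 0 & f 1 = 1].

(* For curves and reparametrizations the set below is the continuous image of
   a compact set, so its supremum is a maximum. *)
Definition max_dist {R : realType} {d : nat} (sigma tau : R -> 'rV[R]_d)
    (f g : R -> R) : R :=
  sup [set enorm (sigma (f t) - tau (g t)) | t in `[0, 1]%classic].

Definition weak_frechet {R : realType} {d : nat}
    (sigma tau : R -> 'rV[R]_d) : R :=
  inf [set r | exists f g : R -> R,
    [/\ reparam f, reparam g & r = max_dist sigma tau f g]].

Definition frechet {R : realType} {d : nat}
    (sigma tau : R -> 'rV[R]_d) : R :=
  inf [set r | exists f g : R -> R,
    [/\ reparam f /\ set_bij `[0, 1]%classic `[0, 1]%classic f,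
        reparam g /\ set_bij `[0, 1]%classic `[0, 1]%classic g &
        r = max_dist sigma tau f g]].

Definition collinear {R : realType} {d : nat} (x y z : 'rV[R]_d) : Prop :=
  exists p u : 'rV[R]_d, u != 0 /\
    exists a b c : R, [/\ x = p + a *: u, y = p + b *: u & z = p + c *: u].

(* Sequences are indexed from 0: v`_i is the vertex v_(i+1). *)
Definition interpolates {R : realType} {d : nat} (t : seq R)
    (v : seq 'rV[R]_d) (tau : R -> 'rV[R]_d) : Prop :=
  forall (i : nat) (s : R), (i.+1 < size v)%N -> t`_i <= s <= t`_i.+1 ->
    tau s = v`_i + ((s - t`_i) / (t`_i.+1 - t`_i)) *: (v`_i.+1 - v`_i).

(* Consecutive vertices on no common line and the two end instants 0 <> 1 make
   the vertices and instants determined by the curve (for d > 0), so carrying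
   them as data is harmless. *)
Record polygonal_curve (R : realType) (d : nat) : Type := PolygonalCurve {
  curve_fun :> R -> 'rV[R]_d;
  vertices : seq 'rV[R]_d;
  instants : seq R;
  curve_funP : is_curve curve_fun;
  size_instants : size instants = size vertices;
  instants_first : head 1 instants = 0;
  instants_last : last 0 instants = 1;
  instants_lt : sorted <%R instants;
  vertices_noncollinear : forall i : nat, (i.+2 < size vertices)%N ->
    ~ collinear vertices`_i vertices`_i.+1 vertices`_i.+2;
  curve_fun_interpolates : interpolates instants vertices curve_fun }.

Definition complexity {R : realType} {d : nat}
  (tau : polygonal_curve R d) : nat := size (vertices tau).

(* On [t`_k, t`_k.+1] the clamped ratio is 1 for i < k and 0 for i > k, so the
   sum telescopes to linear interpolation, see pl_curve_interpolates. *)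
Definition pl_curve {R : realType} {d : nat} (t : seq R) (v : seq 'rV[R]_d)
    (s : R) : 'rV[R]_d :=
  v`_0 + \sum_(i < (size v).-1)
    Num.max 0 (Num.min 1 ((s - t`_i) / (t`_i.+1 - t`_i))) *:
      (v`_i.+1 - v`_i).

Lemma pl_curve_interpolates (R : realType) (d : nat) (t : seq R)
    (v : seq 'rV[R]_d) :
  size t = size v -> sorted <%R t -> interpolates t v (pl_curve t v).
Proof.
move=> stv st k s ksv /andP[tks stk].
have tmono i j : (i < j)%N -> (j < size v)%N -> t`_i < t`_j.
  move=> ij jv; apply: (sorted_ltn_nth lt_trans) => //; rewrite inE stv //.
  exact: ltn_trans jv.
have tmonoW i j : (i <= j)%N -> (j < size v)%N -> t`_i <= t`_j.
  by rewrite leq_eqVlt => /orP[/eqP->//|ij] jv; exact/ltW/tmono.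
pose F i := Num.max 0 (Num.min 1 ((s - t`_i) / (t`_i.+1 - t`_i))) *:
  (v`_i.+1 - v`_i).
rewrite /pl_curve -(big_mkord xpredT F).
have kv : (k.+1 <= (size v).-1)%N by case: (size v) ksv.
have before : \sum_(0 <= i < k) F i = v`_k - v`_0.
  rewrite -telescope_sumr//; apply: eq_big_nat => i /andP[_ ik].
  have i1v : (i.+1 < size v)%N by apply: ltn_trans ksv; rewrite ltnS.
  rewrite /F min_l; first by rewrite max_r ?scale1r.
  rewrite ler_pdivlMr ?subr_gt0 ?tmono// mul1r lerD2r.
  by apply: le_trans tks; apply: tmonoW => //; exact: ltnW.
have after : \sum_(k.+1 <= i < (size v).-1) F i = 0.
  rewrite big_nat; apply: big1 => i /andP[ki iv].
  have i1v : (i.+1 < size v)%N by case: (size v) iv.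
  rewrite /F max_l ?scale0r// ge_min; apply/orP; right.
  rewrite pmulr_lle0 ?invr_gt0 ?subr_gt0 ?tmono// subr_le0.
  by apply: (le_trans stk); apply: tmonoW => //; exact: ltnW.
rewrite (big_cat_nat (leq0n k) (ltnW kv)) /= (big_ltn kv) before after addr0.
rewrite addrA subrKC /F min_r; last first.
  by rewrite ler_pdivrMr ?subr_gt0 ?tmono// mul1r lerD2r.
by rewrite max_r// divr_ge0// subr_ge0// tmonoW.
Qed.

(* All linear maps R^d -> R^d' are v |-> v *m A, as vectors are rows. *)
Definition image_curve {R : realType} {d d' : nat} (A : 'M[R]_(d, d'))
    (tau : polygonal_curve R d) : R -> 'rV[R]_d' :=
  pl_curve (instants tau) [seq v *m A | v <- vertices tau].

(* Linear maps R^d -> R^d' with the Borel sigma-algebra. *)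
Definition borel_matrix (R : realType) (d d' : nat) :=
  g_sigma_algebraType (@open 'M[R]_(d, d')).

Definition distances_preserved {R : realType} {d d' : nat} (eps : R)
    (A : 'M[R]_(d, d')) (sigma tau : polygonal_curve R d) : Prop :=
  `|weak_frechet sigma tau
     - weak_frechet (image_curve A sigma) (image_curve A tau)|
    <= eps * weak_frechet sigma tau /\
  `|frechet sigma tau - frechet (image_curve A sigma) (image_curve A tau)|
    <= eps * frechet sigma tau.

(* Main.v *)
(* Every point of a curve lies on one of its edges, so the difference of points
   of two curves lies in one of at most (nm)^2 subspaces of dimension 3, one for
   each pair of edges.  A linear map that preserves the norm on these subspaces up
   to a factor 1 +- eps preserves all pointwise distances, hence the maximum along
   any pair of reparametrizations and the infima d_wF and d_F.  By polarization it
   suffices to control the norms of the midpoints of pairs of vectors of an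
   orthonormal basis, 9 vectors per subspace, which is the Johnson-Lindenstrauss
   lemma for 9 (nm)^2 vectors.  The latter is proved by derandomizing the sign
   matrix: the entries are fixed one at a time, by the method of conditional
   expectations applied to an exponential potential.  As the distribution may
   depend on T, a point mass at the resulting map will do. *)
Require Import Defs.
From mathcomp Require Import all_boot all_order all_algebra.
From mathcomp Require Import all_classical all_reals all_analysis.
From mathcomp Require Import ring lra.
Set Implicit Arguments.
Unset Strict Implicit.
Unset Printing Implicit Defensive.
Import Order.TTheory GRing.Theory Num.Theory.
Import numFieldNormedType.Exports.
Local Open Scope classical_set_scope.
Local Open Scope ring_scope.

(** * Squared Euclidean norms *)

Definition sqnorm {R : realType} {d : nat} (v : 'rV[R]_d) : R :=
  \sum_(i < d) v ord0 i ^+ 2.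

Lemma sqnorm_ge0 (R : realType) (d : nat) (v : 'rV[R]_d) : 0 <= sqnorm v.
Proof. by apply: sumr_ge0 => i _; exact: sqr_ge0. Qed.

Lemma sqnormE (R : realType) (d : nat) (v : 'rV[R]_d) :
  sqnorm v = (v *m v^T) 0 0.
Proof. by rewrite mxE; apply: eq_bigr => i _; rewrite mxE expr2. Qed.

Lemma sqnormZ (R : realType) (d : nat) (a : R) (v : 'rV[R]_d) :
  sqnorm (a *: v) = a ^+ 2 * sqnorm v.
Proof. by rewrite mulr_sumr; apply: eq_bigr => i _; rewrite mxE exprMn. Qed.

Lemma sqnorm_row_mx (R : realType) (d1 d2 : nat) (u : 'rV[R]_d1)
    (v : 'rV[R]_d2) : sqnorm (row_mx u v) = sqnorm u + sqnorm v.
Proof.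
rewrite /sqnorm big_split_ord; congr (_ + _); apply: eq_bigr => i _.
  by rewrite row_mxEl.
by rewrite row_mxEr.
Qed.

Lemma sqnorm_rV1 (R : realType) (v : 'rV[R]_1) : sqnorm v = v 0 0 ^+ 2.
Proof. by rewrite /sqnorm big_ord1. Qed.

(** * Johnson-Lindenstrauss lemma by conditional expectations *)

(** Sub-Gaussian bound for a random sign; the non-optimal constant 2 lets everything follow from
    [1 + x <= expR x] and monotonicity. *)
Lemma expR_mean_le (R : realType) (y : R) :
  (expR y + expR (- y)) / 2 <= expR (2 * y ^+ 2).
Proof.
wlog y0 : y / 0 <= y.
  move=> H; case: (leP 0 y) => [/H//|y0].
  have := H (- y); rewrite opprK sqrrN addrC => -> //.
  by rewrite oppr_ge0 ltW.
(* For large [y], [y <= 2 * y ^+ 2] bounds both exponentials. For small [y], [expR y <= 1 / (1 - y)]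
   and [expR (- y) <= 1 / (1 + y)], so the mean is at most [1 / (1 - y ^+ 2) <= 1 + 2 * y ^+ 2]. *)
case: (leP (y ^+ 2) (1/2)) => y2; last first.
  have yh : 1 / 2 <= y.
    rewrite leNgt; apply/negP => yh.
    have : y ^+ 2 <= y * (1 / 2) by rewrite expr2 ler_wpM2l// ltW.
    lra.
  have yle : y <= 2 * y ^+ 2.
    have : y * (1 / 2) <= y * y by rewrite ler_wpM2l.
    by rewrite -expr2; lra.
  have : expR (- y) <= expR y by rewrite ler_expR; lra.
  have : expR y <= expR (2 * y ^+ 2) by rewrite ler_expR.
  lra.
have y1 : y < 1.
  rewrite ltNge; apply/negP => y1.
  have : 1 * y <= y * y by rewrite ler_wpM2r.
  by rewrite -expr2; lra.
apply: le_trans (expR_ge1Dx _).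
have ep : expR y * expR (- y) = 1 by rewrite -expRD subrr expR0.
have := expR_ge1Dx y; have := expR_ge1Dx (- y).
have := expR_gt0 y; have := expR_gt0 (- y).
move: (expR y) (expR (- y)) ep => a b ep b0 a0 b1 a1.
have ha : a * (1 - y) <= 1 by rewrite -[leRHS]ep ler_pM2l.
have hb : b * (1 + y) <= 1 by rewrite -[leRHS]ep [leRHS]mulrC ler_pM2l.
have hs : (a + b) / 2 * (1 - y ^+ 2) <= 1.
  have ha' : a * (1 - y) * (1 + y) <= 1 * (1 + y) by rewrite ler_pM2r//; lra.
  have hb' : b * (1 + y) * (1 - y) <= 1 * (1 - y) by rewrite ler_pM2r//; lra.
  have -> : (a + b) / 2 * (1 - y ^+ 2) =
    (a * (1 - y) * (1 + y) + b * (1 + y) * (1 - y)) / 2 by field.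
  lra.
have h : 1 <= (1 + 2 * y ^+ 2) * (1 - y ^+ 2).
  have -> : (1 + 2 * y ^+ 2) * (1 - y ^+ 2) = 1 + y ^+ 2 * (1 - 2 * y ^+ 2).
    by ring.
  by rewrite lerDl mulr_ge0 ?sqr_ge0//; lra.
have : (a + b) / 2 * (1 - y ^+ 2) <= (1 + 2 * y ^+ 2) * (1 - y ^+ 2) by lra.
by rewrite ler_pM2r //; lra.
Qed.

(** Only the cross term [2 * lam * x * w] changes sign, and twice its square is at most
    [32 * L ^+ 2 * x ^+ 2 * w ^+ 2]. *)
Lemma expR_sqr_mean_le (R : realType) (lam L x w : R) :
  `|lam| <= 2 * L ->
  (expR (lam * (x + w) ^+ 2) + expR (lam * (x - w) ^+ 2)) / 2 <=
  expR (lam * (x ^+ 2 + w ^+ 2) + 32 * L ^+ 2 * x ^+ 2 * w ^+ 2).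
Proof.
move=> lamL.
have -> : lam * (x + w) ^+ 2 = lam * (x ^+ 2 + w ^+ 2) + 2 * lam * x * w by ring.
have -> : lam * (x - w) ^+ 2 = lam * (x ^+ 2 + w ^+ 2) + - (2 * lam * x * w).
  by ring.
rewrite !expRD -mulrDr -[leLHS]mulrA ler_pM2l ?expR_gt0//.
apply: (le_trans (expR_mean_le _)); rewrite ler_expR.
have l2 : lam ^+ 2 <= 4 * L ^+ 2.
  rewrite -[lam ^+ 2]real_normK ?num_real//.
  have -> : 4 * L ^+ 2 = (2 * L) ^+ 2 by ring.
  by rewrite lerXn2r ?nnegrE// (le_trans _ lamL).
have : lam ^+ 2 * (x * w) ^+ 2 <= 4 * L ^+ 2 * (x * w) ^+ 2.
  by rewrite ler_wpM2r ?sqr_ge0.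
by rewrite !exprMn; lra.
Qed.

(* The right-hand side bounds the average of the left-hand side over all signs,
   and fixing the signs one at a time can keep it from increasing. *)
Lemma sign_column (R : realType) (I : finType) (L : R) (d : nat)
    (lam x y : I -> R) (W : I -> 'rV[R]_d) :
  L <= 1 / 32 -> (forall a, `|lam a| <= L) -> (forall a, sqnorm (W a) <= 1) ->
  exists s : 'cV[R]_d,
    \sum_a expR (lam a * (x a + (W a *m s) 0 0) ^+ 2 + y a) <=
    \sum_a expR ((lam a + 32 * L ^+ 2 * sqnorm (W a)) * x a ^+ 2 +
      lam a * sqnorm (W a) + 32 * L ^+ 2 * sqnorm (W a) ^+ 2 + y a).
Proof.
move=> L32 lamL; elim: d x W => [|d IH] x W W1.
  exists 0; apply: ler_sum => a _.
  by rewrite mulmx0 mxE /sqnorm big_ord0 ler_expR; lra.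
pose w a := W a ord0 ord0.
pose V a : 'rV[R]_d := @rsubmx R 1 1 d (W a).
have WE a : W a = row_mx (w a)%:M (V a).
  have <- : @lsubmx R 1 1 d (W a) = (w a)%:M.
    apply/matrixP => i j; rewrite !ord1 !mxE eqxx mulr1n /w.
    by congr (W a _ _); apply/val_inj.
  by rewrite (@hsubmxK R 1 1 d).
have NE a : sqnorm (W a) = w a ^+ 2 + sqnorm (V a).
  by rewrite WE (sqnorm_row_mx (w a)%:M (V a)) sqnorm_rV1 mxE eqxx mulr1n.
have V1 a : sqnorm (V a) <= 1.
  by apply: le_trans (W1 a); rewrite NE lerDr sqr_ge0.
(* [B] is the induction bound for the remaining coordinates [V] once the first sign has moved the
   partial sum to [z]; [G] is the bound before that choice. *)
pose B a z := expR ((lam a + 32 * L ^+ 2 * sqnorm (V a)) * z ^+ 2 +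
      lam a * sqnorm (V a) + 32 * L ^+ 2 * sqnorm (V a) ^+ 2 + y a).
pose G a := expR ((lam a + 32 * L ^+ 2 * sqnorm (W a)) * x a ^+ 2 +
      lam a * sqnorm (W a) + 32 * L ^+ 2 * sqnorm (W a) ^+ 2 + y a).
suff [e He] : exists e : R, \sum_a B a (x a + e * w a) <= \sum_a G a.
  have [s Hs] := IH (fun a => x a + e * w a) V V1.
  exists (col_mx e%:M s : 'cV[R]_(1 + d)).
  apply: le_trans He; apply: le_trans Hs; apply: ler_sum => a _.
  rewrite WE (@mul_row_col R 1 1 d 1) -scalar_mxM mxE mxE eqxx mulr1n.
  by rewrite addrA [w a * e]mulrC.
have avg : \sum_a B a (x a + 1 * w a) + \sum_a B a (x a + (-1) * w a) <=
    2 * \sum_a G a.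
  rewrite -big_split mulr_sumr; apply: ler_sum => a _ /=.
  rewrite /B /G mul1r mulN1r NE; set N := sqnorm (V a).
  have N0 : 0 <= N := sqnorm_ge0 _.
  have L0 : 0 <= L := le_trans (normr_ge0 _) (lamL a).
  (* The accumulated correction stays below [L] because [L <= 1 / 32] and [N <= 1]. *)
  have lam2 : `|lam a + 32 * L ^+ 2 * N| <= 2 * L.
    apply: (le_trans (ler_normD _ _)); rewrite [`|_ * N|]ger0_norm; last first.
      by rewrite !mulr_ge0 ?sqr_ge0.
    have -> : 2 * L = L + L by ring.
    apply: lerD => //.
    have : L ^+ 2 * N <= L ^+ 2 by rewrite ler_piMr ?sqr_ge0// V1.
    have : L ^+ 2 <= L / 32 by rewrite expr2 ler_wpM2l//; lra.
    lra.
  have := expR_sqr_mean_le (x a) (w a) lam2.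
  set p := lam a + _ => h.
  set r := lam a * N + 32 * L ^+ 2 * N ^+ 2 + y a.
  have Bsplit z : expR (p * z + lam a * N + 32 * L ^+ 2 * N ^+ 2 + y a) =
      expR (p * z) * expR r by rewrite -expRD /r !addrA.
  rewrite !Bsplit -mulrDl.
  apply: (@le_trans _ _
    (2 * (expR (p * (x a ^+ 2 + w a ^+ 2) + 32 * L ^+ 2 * x a ^+ 2 * w a ^+ 2) *
      expR r))).
    by rewrite mulrA ler_pM2r ?expR_gt0//; lra.
  rewrite ler_pM2l// -expRD ler_expR /p /r.
  (* This is exactly the slack between the two exponents. *)
  have h0 : 0 <= 32 * (L ^+ 2 * w a ^+ 2 * (w a ^+ 2 + N)).
    by rewrite mulr_ge0// mulr_ge0 ?addr_ge0 ?sqr_ge0// mulr_ge0 ?sqr_ge0.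
  by rewrite -subr_ge0; apply: le_trans h0 _; rewrite le_eqVlt;
    apply/orP; left; apply/eqP; ring.
(* One of the two signs does no worse than their average. *)
case: (leP (\sum_a B a (x a + 1 * w a)) (\sum_a G a)) => h1; first by exists 1.
exists (-1); lra.
Qed.

Lemma sign_matrix (R : realType) (I : finType) (L : R) (d k : nat)
    (lam y : I -> R) (W : I -> 'rV[R]_d) :
  L <= 1 / 32 -> (forall a, `|lam a| <= L) -> (forall a, sqnorm (W a) <= 1) ->
  exists S : 'M[R]_(d, k),
    \sum_a expR (lam a * sqnorm (W a *m S) + y a) <=
    \sum_a expR (k%:R * (lam a * sqnorm (W a) +
      32 * L ^+ 2 * sqnorm (W a) ^+ 2) + y a).
Proof.
move=> L32 lamL W1; elim: k y => [|k IH] y.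
  exists 0; apply: ler_sum => a _.
  by rewrite /sqnorm big_ord0 mulr0 mul0r.
(* The column [s] is chosen against the bound for the [k] columns still open; these are then chosen
   with the exact contribution of [s] in the offset. *)
have [s Hs] := sign_column (fun _ => 0) (fun a => k%:R *
  (lam a * sqnorm (W a) + 32 * L ^+ 2 * sqnorm (W a) ^+ 2) + y a) L32 lamL W1.
have [S HS] := IH (fun a => lam a * ((W a *m s) 0 0) ^+ 2 + y a).
exists (row_mx s S : 'M[R]_(d, 1 + k)).
have -> : \sum_a expR (lam a * sqnorm (W a *m (row_mx s S : 'M[R]_(d, 1 + k))) + y a)
    = \sum_a expR (lam a * sqnorm (W a *m S) +
        (lam a * (W a *m s) 0 0 ^+ 2 + y a)).
  apply: eq_bigr => a _; rewrite mul_mx_row sqnorm_row_mx sqnorm_rV1.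
  by congr expR; ring.
apply: (le_trans HS).
have -> : \sum_a expR (k.+1%:R * (lam a * sqnorm (W a) +
      32 * L ^+ 2 * sqnorm (W a) ^+ 2) + y a) =
  \sum_a expR ((lam a + 32 * L ^+ 2 * sqnorm (W a)) * 0 ^+ 2 +
      lam a * sqnorm (W a) + 32 * L ^+ 2 * sqnorm (W a) ^+ 2 + (k%:R *
  (lam a * sqnorm (W a) + 32 * L ^+ 2 * sqnorm (W a) ^+ 2) + y a)).
  by apply: eq_bigr => a _; congr expR; rewrite -natr1; ring.
apply: le_trans Hs; apply: ler_sum => a _; rewrite ler_expR add0r.
by rewrite le_eqVlt; apply/orP; left; apply/eqP; ring.
Qed.

Lemma johnson_lindenstrauss (R : realType) (I : finType) (delta : R)
    (d k : nat) (W : I -> 'rV[R]_d) :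
  0 < delta -> delta <= 1 -> (0 < #|I|)%N -> (0 < k)%N ->
  128 * ln (2 * #|I|)%:R <= k%:R * delta ^+ 2 ->
  (forall a, sqnorm (W a) <= 1) ->
  exists A : 'M[R]_(d, k),
    forall a, `|sqnorm (W a *m A) - sqnorm (W a)| <= delta.
Proof.
move=> d0 d1 I0 k0 hk W1.
(* With this [L], the target [k%:R * delta * L] splits into two equal halves:
   [k%:R * delta ^+ 2 / 128] pays for the logarithm and [32 * L ^+ 2 * k%:R] for the second-order
   term. *)
pose L := delta / 64.
(* Doubling the index set by a sign puts both tails into one potential. *)
pose lam (a : bool * I) : R := (-1) ^+ a.1 * L.
have L0 : 0 < L by rewrite divr_gt0.
have lamL a : `|lam a| <= L.
  by rewrite normrM normrX normrN1 expr1n mul1r gtr0_norm.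
have L32 : L <= 1 / 32 by rewrite /L; lra.
have kR : 0 < k%:R :> R by rewrite ltr0n.
have [S HS] := sign_matrix k
  (fun a => - (k%:R * (lam a * sqnorm (W a.2)))) L32 lamL (fun a => W1 a.2).
have bound (a : bool * I) :
    lam a * (sqnorm (W a.2 *m S) - k%:R * sqnorm (W a.2)) <= k%:R * delta * L.
  (* A single term is at most the whole potential, all its terms being positive. *)
  have h1 : expR (lam a * (sqnorm (W a.2 *m S) - k%:R * sqnorm (W a.2))) <=
      (2 * #|I|)%:R * expR (32 * L ^+ 2 * k%:R).
    have -> : lam a * (sqnorm (W a.2 *m S) - k%:R * sqnorm (W a.2)) =
      lam a * sqnorm (W a.2 *m S) - k%:R * (lam a * sqnorm (W a.2)) by ring.
    apply: (@le_trans _ _ (\sum_a0 expR (lam a0 * sqnorm (W a0.2 *m S) -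
        k%:R * (lam a0 * sqnorm (W a0.2))))).
      rewrite (bigD1 a) //= lerDl; apply: sumr_ge0 => i _; exact: expR_ge0.
    apply: (le_trans HS).
    have <- : \sum_(b : bool * I) expR (32 * L ^+ 2 * k%:R) =
        (2 * #|I|)%:R * expR (32 * L ^+ 2 * k%:R).
      by rewrite sumr_const card_prod card_bool [RHS]mulr_natl.
    apply: ler_sum => b _; rewrite ler_expR mulrDr addrAC subrr add0r.
    rewrite mulrC ler_wpM2r ?ler0n//.
    by rewrite ler_piMr ?exprn_ile1 ?sqnorm_ge0 ?W1// mulr_ge0 ?sqr_ge0.
  have N0 : 0 < (2 * #|I|)%:R :> R by rewrite ltr0n muln_gt0.
  rewrite -ler_ln ?posrE ?expR_gt0 ?mulr_gt0 ?expR_gt0// in h1.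
  rewrite lnM ?posrE ?expR_gt0// !expRK in h1.
  apply: (le_trans h1).
  have -> : k%:R * delta * L = (k%:R * delta ^+ 2) / 128 + 32 * L ^+ 2 * k%:R.
    by rewrite /L; field.
  by rewrite lerD2r; lra.
exists ((Num.sqrt k%:R)^-1 *: S) => a.
rewrite -scalemxAr sqnormZ exprVn sqr_sqrtr ?ler0n//.
have -> : k%:R^-1 * sqnorm (W a *m S) - sqnorm (W a) =
    (sqnorm (W a *m S) - k%:R * sqnorm (W a)) / k%:R by field; rewrite gt_eqF.
rewrite normrM normfV (gtr0_norm kR) ler_pdivrMr// [leRHS]mulrC.
have := bound (false, a); have := bound (true, a).
rewrite /lam /= expr0 expr1 mulN1r mul1r !mulNr ![L * _]mulrC -mulNr.
rewrite !ler_pM2r// ler_norml => h1 h2.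
by rewrite h2 andbT lerNl.
Qed.

(** * Orthonormal bases and polarization *)

(** The zero vector is normalized to zero, so that dependent rows need no separate treatment below.
    The factor [b] transfers orthogonality from [r] to [e]. *)
Lemma normalized_vector (R : realType) (d : nat) (r : 'rV[R]_d) :
  exists e b, [/\ e = b *: r, r *m e^T *m e = r & e *m e^T *m e = e].
Proof.
have [r0|r0] := eqVneq (sqnorm r) 0.
  have {}r0 : r = 0.
    apply/rowP => i; rewrite mxE; apply/eqP; rewrite -sqrf_eq0.
    move/eqP: r0; rewrite psumr_eq0 => [/allP|j _]; last exact: sqr_ge0.
    by move=> /(_ i (mem_index_enum i)).
  by exists 0, 0; rewrite r0 scaler0 !mulmx0.
pose b := (Num.sqrt (sqnorm r))^-1.
have rr : r *m r^T = (sqnorm r)%:M by rewrite [LHS]mx11_scalar sqnormE.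
have b2 : b * (b * sqnorm r) = 1.
  by rewrite mulrA -expr2 exprVn sqr_sqrtr ?sqnorm_ge0// mulVf.
have trZ : (b *: r)^T = b *: r^T by apply/colP => i; rewrite !mxE.
exists (b *: r), b; split => //.
  rewrite trZ -!scalemxAr -scalemxAl rr mul_scalar_mx !scalerA.
  by rewrite -mulrA b2 scale1r.
rewrite trZ -!scalemxAr -!scalemxAl rr mul_scalar_mx !scalerA.
by rewrite -!mulrA b2 mulr1.
Qed.

(* [E^T *m E] is the orthogonal projection onto the row space of [B]. *)
Lemma gram_schmidt (R : realType) (d k : nat) (B : 'M[R]_(k, d)) :
  exists E : 'M[R]_(k, d), B *m E^T *m E = B /\ E *m E^T *m E = E.
Proof.
elim: k B => [|k IH] B.
  by exists 0; split; apply/matrixP => -[].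
move: B; rewrite -[k.+1]/(1 + k)%N => B.
have [E [BE EE]] := IH (@dsubmx R 1 k d B).
pose u := @usubmx R 1 k d B; pose B' := @dsubmx R 1 k d B.
have BE0 : B = col_mx u B' by rewrite [LHS](esym (@vsubmxK R 1 k d B)).
pose P := E^T *m E.
have PT : P^T = P by rewrite trmx_mul trmxK.
have BP : B' *m P = B' by rewrite mulmxA.
have EP : E *m P = E by rewrite mulmxA.
have PP : P *m P = P by rewrite {1}/P -mulmxA EP.
(* The part of the new row orthogonal to the previous ones. *)
pose r := u - u *m P.
have rP : r *m P = 0 by rewrite mulmxBl -mulmxA PP subrr.
have rT : r^T = u^T - P *m u^T by rewrite linearB /= trmx_mul PT.
have BrT : B' *m r^T = 0 by rewrite rT mulmxBr mulmxA BP subrr.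
have ErT : E *m r^T = 0 by rewrite rT mulmxBr mulmxA EP subrr.
have [e [b [eE re ee]]] := normalized_vector r.
have BeT : B' *m e^T = 0 by rewrite eE linearZ /= -scalemxAr BrT scaler0.
have EeT : E *m e^T = 0 by rewrite eE linearZ /= -scalemxAr ErT scaler0.
have eP : e *m P = 0 by rewrite eE -scalemxAl rP scaler0.
have eET : e *m E^T = 0 by rewrite -[LHS]trmxK trmx_mul trmxK EeT trmx0.
have ue : u *m e^T *m e = r.
  have -> : u = r + u *m P by rewrite subrK.
  by rewrite mulmxDl -(mulmxA u) /P -(mulmxA E^T) EeT !mulmx0 addr0.
exists (col_mx e E : 'M[R]_(1 + k, d)).
have proj (n : nat) (X : 'M[R]_(n, d)) : X *m (col_mx e E)^T *m col_mx e E =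
    X *m e^T *m e + X *m P.
  by rewrite tr_col_mx mul_mx_row mul_row_col mulmxA.
split.
  rewrite {2}BE0 {1}BE0 proj !mul_col_mx BeT mul0mx BP ue add_col_mx add0r.
  by rewrite subrK.
by rewrite proj !mul_col_mx ee EeT mul0mx eP EP add_col_mx addr0 add0r.
Qed.

(** The Gram matrix [G] is symmetric and idempotent, so [G i i] is the sum of the squares of its row
    and hence at least [G i i ^+ 2]. *)
Lemma projection_row_le1 (R : realType) (d k : nat) (E : 'M[R]_(k, d)) i :
  E *m E^T *m E = E -> sqnorm (row i E) <= 1.
Proof.
move=> EE; set G := E *m E^T.
have GG : G *m G = G by rewrite {2}/G mulmxA EE.
have GT : G^T = G by rewrite trmx_mul trmxK.
have -> : sqnorm (row i E) = G i i.
  by rewrite mxE; apply: eq_bigr => j _; rewrite !mxE expr2.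
have : G i i ^+ 2 <= G i i.
  rewrite [leRHS](_ : _ = \sum_j G i j ^+ 2); last first.
    rewrite -[in LHS]GG -{2}GT [LHS]mxE; apply: eq_bigr => j _.
    by rewrite [_^T _ _]mxE expr2.
  by rewrite (bigD1 i)//= lerDl; apply: sumr_ge0 => j _; exact: sqr_ge0.
case: (leP (G i i) 1) => // h.
have : 1 * G i i < G i i * G i i by rewrite ltr_pM2r//; lra.
by rewrite -expr2; lra.
Qed.

(** Each product of two coordinates is at most the mean of their squares in absolute value. *)
Lemma quadratic_form_le (R : realType) (k : nat) (delta : R) (c : 'rV[R]_k)
    (M : 'M[R]_k) :
  (forall i j, `|M i j| <= delta) ->
  `|(c *m M *m c^T) 0 0| <= k%:R * delta * sqnorm c.
Proof.
move=> HM; rewrite mxE; under eq_bigr do rewrite [_^T _ _]mxE mxE mulr_suml.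
apply: (le_trans (ler_norm_sum _ _ _)).
apply: (@le_trans _ _ (\sum_i \sum_j
    delta * ((c 0 j ^+ 2 + c 0 i ^+ 2) / 2))).
  apply: ler_sum => i _; apply: (le_trans (ler_norm_sum _ _ _)).
  apply: ler_sum => j _; rewrite !normrM.
  rewrite [`|c 0 j| * _]mulrC -mulrA ler_pM ?mulr_ge0//.
  rewrite -(real_normK (num_real (c 0 j))) -(real_normK (num_real (c 0 i))).
  have := sqr_ge0 (`|c 0 j| - `|c 0 i|); rewrite sqrrB; lra.
have -> : \sum_i \sum_j delta * ((c 0 j ^+ 2 + c 0 i ^+ 2) / 2) =
    \sum_i delta / 2 * (sqnorm c + k%:R * c 0 i ^+ 2).
  apply: eq_bigr => i _; rewrite -mulr_sumr -mulr_suml big_split /=.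
  by rewrite sumr_const card_ord -[_ ^+ 2 *+ _]mulr_natl mulrAC mulrA.
rewrite -mulr_sumr big_split sumr_const card_ord /= -mulr_sumr -/(sqnorm c).
rewrite -[sqnorm c *+ _]mulr_natl le_eqVlt; apply/orP; left; apply/eqP.
by move: (sqnorm c) => N; field.
Qed.

(* Polarization: the entries of [E *m (A *m A^T - 1) *m E^T] are combinations of
   the defects of the midpoints of pairs of rows of [E]. *)
Lemma sqnorm_span (R : realType) (d d' k : nat) (delta : R)
    (B E : 'M[R]_(k, d)) (A : 'M[R]_(d, d')) (a : 'rV[R]_k) :
  B *m E^T *m E = B ->
  (forall i j : 'I_k,
     `|sqnorm (2^-1 *: (row i E + row j E) *m A) -
       sqnorm (2^-1 *: (row i E + row j E))| <= delta) ->
  `|sqnorm (a *m B *m A) - sqnorm (a *m B)|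
    <= k%:R * (3 * delta) * sqnorm (a *m B).
Proof.
move=> BE H.
pose D := A *m A^T - 1%:M.
have DE (w : 'rV[R]_d) : sqnorm (w *m A) - sqnorm w = (w *m D *m w^T) 0 0.
  by rewrite !sqnormE trmx_mul /D mulmxBr mulmxBl mulmx1 !mulmxA !mxE.
have DT : D^T = D by rewrite linearB /= trmx_mul trmxK trmx1.
clearbody D.
pose M := E *m D *m E^T.
have ME i j : M i j = (row i E *m D *m (row j E)^T) 0 0.
  by rewrite /M -row_mul !mxE; apply: eq_bigr => l _; rewrite !mxE.
have MT : M^T = M by rewrite !trmx_mul trmxK DT mulmxA.
have MC i j : M i j = M j i by rewrite -[in LHS]MT [LHS]mxE.
have Hw i j : sqnorm (2^-1 *: (row i E + row j E) *m A) -
    sqnorm (2^-1 *: (row i E + row j E)) =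
    (M i i + M j j + 2 * M i j) / 4.
  rewrite DE.
  have -> : (2^-1 *: (row i E + row j E))^T =
    2^-1 *: ((row i E)^T + (row j E)^T) by apply/colP => l; rewrite !mxE.
  have add4 (X Y Z T : 'M[R]_1) : (X + Y + (Z + T)) 0 0 =
    X 0 0 + Y 0 0 + (Z 0 0 + T 0 0) by rewrite !mxE.
  rewrite -scalemxAr -!scalemxAl !mulmxDl !mulmxDr mxE [X in _ * X]mxE.
  by rewrite add4 -!ME [M j i]MC; field.
have Mdiag i : `|M i i| <= delta.
  have := H i i; rewrite Hw.
  by have -> : (M i i + M i i + 2 * M i i) / 4 = M i i by field.
(* Solving [Hw] for [2 * M i j] leaves errors [4 * delta], [delta] and [delta]. *)
have Mle i j : `|M i j| <= 3 * delta.
  have := Mdiag i; have := Mdiag j; have := H i j; rewrite Hw.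
  rewrite !ler_norml; lra.
(* [c] holds the coordinates of [u] with respect to the rows of [E]; passing to them keeps the
   norm. *)
set u := a *m B; pose c := u *m E^T.
have uE : u = c *m E by rewrite /c /u -!mulmxA (mulmxA B) BE.
rewrite DE; have -> : sqnorm u = sqnorm c.
  have cT : c^T = E *m u^T by rewrite trmx_mul trmxK.
  by rewrite !sqnormE cT mulmxA -uE.
have -> : u *m D *m u^T = c *m M *m c^T.
  by rewrite uE trmx_mul /M !mulmxA.
exact: quadratic_form_le.
Qed.

(** * From norms to Fréchet distances *)

(** Square roots keep the relative error: [(1 - eps) ^+ 2 <= 1 - eps] and
    [1 + eps <= (1 + eps) ^+ 2]. *)
Lemma enorm_distortion (R : realType) (d d' : nat) (eps : R) (u : 'rV[R]_d)
    (v : 'rV[R]_d') :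
  0 < eps -> eps < 1 -> `|sqnorm v - sqnorm u| <= eps * sqnorm u ->
  (1 - eps) * enorm u <= enorm v <= (1 + eps) * enorm u.
Proof.
move=> e0 e1; rewrite ler_norml => /andP[h1 h2].
have u0 := sqnorm_ge0 u.
have ep : 0 <= eps * sqnorm u by rewrite mulr_ge0// ltW.
have ep2 : 0 <= eps * (eps * sqnorm u) by rewrite mulr_ge0// ltW.
have ep3 : eps * (eps * sqnorm u) <= 1 * (eps * sqnorm u).
  by rewrite ler_wpM2r// ltW.
have E1 : (1 - eps) * enorm u = Num.sqrt ((1 - eps) ^+ 2 * sqnorm u).
  by rewrite sqrtrM ?sqr_ge0// sqrtr_sqr ger0_norm//; lra.
have E2 : (1 + eps) * enorm u = Num.sqrt ((1 + eps) ^+ 2 * sqnorm u).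
  by rewrite sqrtrM ?sqr_ge0// sqrtr_sqr ger0_norm//; lra.
rewrite E1 E2; apply/andP; split; apply: ler_wsqrtr; rewrite -/(sqnorm v).
  have -> : (1 - eps) ^+ 2 * sqnorm u =
    sqnorm u - 2 * (eps * sqnorm u) + eps * (eps * sqnorm u) by ring.
  lra.
have -> : (1 + eps) ^+ 2 * sqnorm u =
  sqnorm u + 2 * (eps * sqnorm u) + eps * (eps * sqnorm u) by ring.
lra.
Qed.

Lemma sup_distortion (R : realType) (I : Type) (D : set I) (eps : R)
    (phi psi : I -> R) :
  eps < 1 -> D !=set0 ->
  (forall i, D i -> (1 - eps) * phi i <= psi i <= (1 + eps) * phi i) ->
  0 <= eps ->
  (1 - eps) * sup (phi @` D) <= sup (psi @` D) <= (1 + eps) * sup (phi @` D).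
Proof.
move=> e1 D0 H e0.
have l0 : 0 < 1 - eps by lra.
have n1 : phi @` D !=set0 by exact: image_nonempty.
have n2 : psi @` D !=set0 by exact: image_nonempty.
have bnd : has_ubound (phi @` D) <-> has_ubound (psi @` D).
  split=> -[M HM].
    exists ((1 + eps) * M) => _ [i Di <-].
    have /andP[_ h] := H i Di; apply: (le_trans h).
    by rewrite ler_wpM2l ?addr_ge0//; apply: HM; exists i.
  exists (M / (1 - eps)) => _ [i Di <-].
  have /andP[h _] := H i Di; rewrite ler_pdivlMr// mulrC.
  by apply: (le_trans h); apply: HM; exists i.
(* Both images are bounded above or neither is; in the latter case both suprema are 0 by
   convention. *)
have [b1|nb] := pselect (has_ubound (phi @` D)); last first.
  rewrite !sup_out ?mulr0 ?lexx// => -[_]; last exact: nb.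
  by move/bnd.2.
have b2 := bnd.1 b1.
apply/andP; split.
  rewrite mulrC -ler_pdivlMr//; apply: ge_sup => // _ [i Di <-].
  have /andP[h _] := H i Di; rewrite ler_pdivlMr// mulrC.
  by apply: (le_trans h); apply: ub_le_sup => //; exists i.
apply: ge_sup => // _ [i Di <-].
have /andP[_ h] := H i Di; apply: (le_trans h).
by rewrite ler_wpM2l ?addr_ge0//; apply: ub_le_sup => //; exists i.
Qed.

Lemma inf_distortion (R : realType) (I : Type) (D : set I) (eps : R)
    (phi psi : I -> R) :
  0 <= eps -> eps < 1 -> (forall i, D i -> 0 <= phi i) ->
  (forall i, D i -> (1 - eps) * phi i <= psi i <= (1 + eps) * phi i) ->
  `|inf (phi @` D) - inf (psi @` D)| <= eps * inf (phi @` D).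
Proof.
move=> e0 e1 phi0 H.
have l0 : 0 < 1 - eps by lra.
have u0 : 0 < 1 + eps by lra.
have [D0|] := pselect (D !=set0); last first.
  move=> /set0P/negP/negPn/eqP ->.
  by rewrite !image_set0 inf0 subr0 normr0 mulr0.
have n1 : phi @` D !=set0 by exact: image_nonempty.
have n2 : psi @` D !=set0 by exact: image_nonempty.
have b1 : has_lbound (phi @` D) by exists 0 => _ [i Di <-]; exact: phi0.
have b2 : has_lbound (psi @` D).
  exists 0 => _ [i Di <-]; have /andP[h _] := H i Di.
  by apply: le_trans h; rewrite mulr_ge0 ?phi0// ltW.
have h1 : (1 - eps) * inf (phi @` D) <= inf (psi @` D).
  apply: lb_le_inf => // _ [i Di <-].
  have /andP[h _] := H i Di; apply: le_trans h.
  by rewrite ler_pM2l//; apply: ge_inf => //; exists i.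
have h2 : inf (psi @` D) <= (1 + eps) * inf (phi @` D).
  rewrite mulrC -ler_pdivrMr//; apply: lb_le_inf => // _ [i Di <-].
  have /andP[_ h] := H i Di; rewrite ler_pdivrMr// mulrC.
  by apply: le_trans h; apply: ge_inf => //; exists i.
rewrite ler_norml; lra.
Qed.

Lemma max_dist_ge0 (R : realType) (d : nat) (sigma tau : R -> 'rV[R]_d)
    (f g : R -> R) : 0 <= max_dist sigma tau f g.
Proof.
rewrite /max_dist; set S := (X in sup X).
have [hS|/sup_out ->//] := pselect (has_sup S).
have [r Sr] := hS.1; apply: le_trans (ub_le_sup hS.2 Sr).
by case: Sr => t _ <-; exact: sqrtr_ge0.
Qed.

Lemma distances_preserved_pointwise (R : realType) (d d' : nat) (eps : R)
    (A : 'M[R]_(d, d')) (sigma tau : polygonal_curve R d) :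
  0 < eps -> eps < 1 ->
  (forall s t : R, 0 <= s <= 1 -> 0 <= t <= 1 ->
    (1 - eps) * enorm (sigma s - tau t) <=
      enorm (image_curve A sigma s - image_curve A tau t) <=
    (1 + eps) * enorm (sigma s - tau t)) ->
  distances_preserved eps A sigma tau.
Proof.
move=> e0 e1 H.
have Hmax f g : reparam f -> reparam g ->
    (1 - eps) * max_dist sigma tau f g <=
      max_dist (image_curve A sigma) (image_curve A tau) f g <=
    (1 + eps) * max_dist sigma tau f g.
  move=> [_ f01 _ _] [_ g01 _ _]; apply: sup_distortion => //; last exact: ltW.
    by exists 0; rewrite /= in_itv /= lexx ler01.
  move=> t /= t01; apply: H.
    by have := f01 t t01; rewrite /= in_itv.
  by have := g01 t t01; rewrite /= in_itv.
(* The curves and their images compete over the same set [D] of pairs of reparametrizations, so both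
   infima become infima of functions on [D]. *)
have imE (n : nat) (s t : R -> 'rV[R]_n) (D : set ((R -> R) * (R -> R))) :
    [set r | exists f g, D (f, g) /\ r = max_dist s t f g] =
    (fun p => max_dist s t p.1 p.2) @` D.
  apply/seteqP; split=> [r [f [g [Dfg ->]]]|r [[f g] Dfg <-]].
    by exists (f, g).
  by exists f, g.
split.
  pose D := [set p : (R -> R) * (R -> R) | reparam p.1 /\ reparam p.2].
  have E n (s t : R -> 'rV[R]_n) : weak_frechet s t =
      inf ((fun p => max_dist s t p.1 p.2) @` D).
    rewrite -imE; congr inf; apply/seteqP.
    by split=> r [f [g]] => [[? ? ?]|[[? ?] ?]]; exists f, g.
  rewrite !E; apply: inf_distortion => //; first exact: ltW.
    by move=> p _; exact: max_dist_ge0.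
  by move=> [f g] [/= rf rg]; exact: Hmax.
pose bij f := @set_bij R R `[0, 1]%classic `[0, 1]%classic f.
pose D := [set p : (R -> R) * (R -> R) |
  (reparam p.1 /\ bij p.1) /\ (reparam p.2 /\ bij p.2)].
have E n (s t : R -> 'rV[R]_n) : frechet s t =
    inf ((fun p => max_dist s t p.1 p.2) @` D).
  rewrite -imE; congr inf; apply/seteqP.
  by split=> r [f [g]] => [[? ? ?]|[[? ?] ?]]; exists f, g.
rewrite !E; apply: inf_distortion => //; first exact: ltW.
  by move=> p _; exact: max_dist_ge0.
by move=> [f g] [/= [rf _] [rg _]]; exact: Hmax.
Qed.

(** * Points on the edges of a curve *)

(** The defaults of [head] and [last] exclude an empty list of instants, and a single instant would
    be both 0 and 1. *)
Lemma size_vertices_gt1 (R : realType) (d : nat) (tau : polygonal_curve R d) :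
  (1 < size (vertices tau))%N.
Proof.
rewrite -size_instants.
case: (instants tau) (instants_first tau) (instants_last tau) => [|x [|y s]] //=.
  by move=> /eqP; rewrite oner_eq0.
by move=> -> /esym/eqP; rewrite oner_eq0.
Qed.

Lemma between_instants (R : realType) (d : nat) (tau : polygonal_curve R d)
    (s : R) : 0 <= s <= 1 ->
  exists2 i, (i.+1 < size (vertices tau))%N &
    (instants tau)`_i <= s <= (instants tau)`_i.+1.
Proof.
move=> /andP[s0 s1].
have sz := size_vertices_gt1 tau.
have t0 : (instants tau)`_0 = 0.
  rewrite nth0 -(instants_first tau).
  by case: (instants tau) (instants_first tau) => //= /eqP; rewrite oner_eq0.
have t1 : (instants tau)`_(size (vertices tau)).-1 = 1.
  by rewrite -size_instants nth_last instants_last.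
(* Descent from the last instant to the first edge whose start is not beyond [s]. *)
have step k : (k.+1 < size (vertices tau))%N -> s <= (instants tau)`_k.+1 ->
    exists2 i, (i.+1 < size (vertices tau))%N &
      (instants tau)`_i <= s <= (instants tau)`_i.+1.
  elim: k => [|k IH] ks sk; first by exists 0%N; rewrite // t0 s0.
  case: (leP s (instants tau)`_k.+1) => h; first exact: IH (ltnW ks) h.
  by exists k.+1; rewrite // (ltW h).
have := step (size (vertices tau)).-2.
case: (size (vertices tau)) sz t1 => [|[|p]] //= _ t1; apply => //.
by rewrite t1.
Qed.

(** The image curve has the same instants, hence the same interpolation ratio, and linear maps
    commute with interpolation. *)
Lemma on_segment (R : realType) (d d' : nat) (A : 'M[R]_(d, d'))
    (tau : polygonal_curve R d) (s : R) : 0 <= s <= 1 ->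
  exists i (b : R), [/\ (i.+1 < size (vertices tau))%N,
    tau s = (vertices tau)`_i +
      b *: ((vertices tau)`_i.+1 - (vertices tau)`_i) &
    image_curve A tau s = tau s *m A].
Proof.
move=> /(between_instants tau)[i iv si].
exists i, ((s - (instants tau)`_i) / ((instants tau)`_i.+1 - (instants tau)`_i)).
have h := curve_fun_interpolates iv si.
split=> //; rewrite h /image_curve.
rewrite (@pl_curve_interpolates _ _ _ _ _ _ i)//; last first.
- by rewrite size_map.
- exact: instants_lt.
- by rewrite size_map size_instants.
rewrite !(nth_map 0) ?size_map//; last exact: ltnW.
by rewrite mulmxDl -scalemxAl mulmxBl.
Qed.

(** * Simultaneous embedding of all pairs of edges *)

(** The rows span all differences between a point of the line through [a], [b] and one of the line
    through [c], [e]. *)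
Definition segment_differences {R : realType} {d : nat}
    (a b c e : 'rV[R]_d) : 'M[R]_(3, d) :=
  \matrix_(i < 3) nth 0 [:: a - c; b - a; e - c] i.

Lemma segment_difference (R : realType) (d : nat) (a b c e : 'rV[R]_d)
    (s t : R) :
  exists x : 'rV[R]_3,
    (a + s *: (b - a)) - (c + t *: (e - c)) = x *m segment_differences a b c e.
Proof.
exists (\row_(i < 3) nth 0 [:: 1; s; - t] i).
rewrite mulmx_sum_row !big_ord_recl big_ord0 !rowK !mxE /=.
by apply/rowP => i; rewrite !mxE; ring.
Qed.

(** Accuracy [eps / 9] compensates the factor [3 * 3] lost by polarization in dimension 3, whence
    81; the 9 midpoints per subspace, with two tails each, give 18. *)
Lemma segments_embedding (R : realType) (J : finType) (eps : R) (d k : nat)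
    (B : J -> 'M[R]_(3, d)) :
  0 < eps -> eps < 1 -> (0 < #|J|)%N -> (0 < k)%N ->
  128 * 81 * ln (18 * #|J|)%:R <= k%:R * eps ^+ 2 ->
  exists A : 'M[R]_(d, k), forall j (x : 'rV[R]_3),
    (1 - eps) * enorm (x *m B j) <= enorm (x *m B j *m A) <=
      (1 + eps) * enorm (x *m B j).
Proof.
move=> e0 e1 J0 k0 hk.
have /choice[E HE] : forall j, exists E : 'M[R]_(3, d),
    B j *m E^T *m E = B j /\ E *m E^T *m E = E by move=> j; exact: gram_schmidt.
pose W (a : J * ('I_3 * 'I_3)) : 'rV[R]_d :=
  2^-1 *: (row a.2.1 (E a.1) + row a.2.2 (E a.1)).
have W1 a : sqnorm (W a) <= 1.
  have h i := projection_row_le1 i (HE a.1).2.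
  have := h a.2.1; have := h a.2.2; rewrite /W.
  move: (row a.2.1 _) (row a.2.2 _) => u v hv hu; rewrite sqnormZ.
  have : sqnorm (u + v) <= 2 * sqnorm u + 2 * sqnorm v.
    rewrite /sqnorm !mulr_sumr -big_split; apply: ler_sum => i _ /=.
    rewrite mxE; have := sqr_ge0 (u ord0 i - v ord0 i); rewrite sqrrB sqrrD; lra.
  have -> : (2^-1 : R) ^+ 2 = 1 / 4 by field.
  lra.
have cardI : #|{: J * ('I_3 * 'I_3)}| = (9 * #|J|)%N.
  by rewrite !card_prod !card_ord mulnC.
have [|||//||//|A HA] := @johnson_lindenstrauss R _ (eps / 9) d k W.
- by rewrite divr_gt0.
- by lra.
- by rewrite cardI muln_gt0.
- by rewrite cardI mulnA exprMn; lra.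
exists A => j x; apply: enorm_distortion => //.
have := @sqnorm_span R d k 3 (eps / 9) (B j) (E j) A x (HE j).1
  (fun i l => HA (j, (i, l))).
by have -> : 3 * (3 * (eps / 9)) = eps by field.
Qed.

(** * Choice of the dimension and conclusion *)

Lemma natural_between (R : realType) (x : R) :
  1 <= x -> exists k : nat, (0 < k)%N /\ x <= k%:R <= 2 * x.
Proof.
move=> x1; exists (Num.trunc x).+1; split=> //.
have /andP[h1 h2] := truncn_itv (le_trans ler01 x1).
by rewrite (ltW h2) -natr1; lra.
Qed.

(** The first bound makes the real target dimension at least 1. The second holds since
    [18 <= 2 ^ 5 <= N ^ 5]. *)
Lemma ln_polynomial (R : realType) (N : nat) : (2 <= N)%N ->
  1 / 2 <= ln (N%:R : R) /\ ln ((18 * N ^ 2)%:R : R) <= 7 * ln (N%:R : R).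
Proof.
move=> N2.
have N0 : (0 : R) < N%:R by rewrite ltr0n (leq_trans _ N2).
split.
  have h : ln (1 + - (1/2) : R) <= - (1/2) by apply: le_ln1Dx; lra.
  have e : 1 + - (1/2) = 2^-1 :> R by field.
  rewrite e lnV ?posrE// in h.
  have : ln (2 : R) <= ln N%:R by rewrite ler_ln ?posrE// ler_nat.
  lra.
have -> : 7 * ln (N%:R : R) = ln ((N ^ 7)%:R).
  by rewrite natrX lnXn// mulr_natl.
rewrite ler_ln ?posrE ?ltr0n ?muln_gt0 ?expn_gt0 ?(leq_trans _ N2)//.
rewrite ler_nat (_ : 7 = 5 + 2)%N// expnD leq_mul2r; apply/orP; right.
by apply: (@leq_trans (2 ^ 5)); rewrite // leq_exp2r.
Qed.

Theorem theorem15 (R : realType) (c : R) (c_gt0 : 0 < c) :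
  exists C : R, 0 < C /\
  forall (eps : R) (n m d : nat) (T : 'I_n -> polygonal_curve R d),
    0 < eps -> eps < 1 -> (0 < n)%N ->
    (forall i : 'I_n, (complexity (T i) <= m)%N) ->
  exists d' : nat,
    d'%:R <= C * eps ^- 2 * ln ((n * m)%:R : R) /\
  exists P : probability (borel_matrix R d d') R,
  exists E : set (borel_matrix R d d'),
    [/\ measurable E,
        ((1 - (n * m)%:R `^ (- c))%:E <= P E)%E &
        forall A : 'M[R]_(d, d'), E A ->
          forall i j : 'I_n, distances_preserved eps A (T i) (T j)].
Proof.
(* The factor 2 pays for rounding, [128 * 81] for the embedding, and 7 for replacing
   [18 * (n * m) ^ 2] by [n * m] in the logarithm. *)
exists (2 * (128 * 81 * 7)); split=> // eps n m d T e0 e1 n0 Tm.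
have m2 : (2 <= m)%N := leq_trans (size_vertices_gt1 _) (Tm (Ordinal n0)).
have [ln_ge ln_le] := @ln_polynomial R (n * m) (leq_trans m2 (leq_pmull m n0)).
have eps2 : 0 < eps ^+ 2 by rewrite exprn_gt0.
have eps21 : eps ^+ 2 <= 1 by rewrite exprn_ile1 ?ltW.
pose X := 128 * 81 * 7 * eps ^- 2 * ln ((n * m)%:R : R).
have XE : X * eps ^+ 2 = 128 * 81 * 7 * ln ((n * m)%:R : R).
  by rewrite /X mulrAC mulfVK// gt_eqF.
have X1 : 1 <= X.
  rewrite -(ler_pM2r eps2) XE mul1r; apply: (le_trans eps21); lra.
have [k [k0 /andP[Xk kX]]] := natural_between X1.
exists k; split; first by apply: (le_trans kX); rewrite /X !mulrA.
(* Indices past the last vertex read the default 0; this only adds further matrices to the family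
   [B]. *)
pose v i l := (vertices (T i))`_l.
pose B (p : ('I_n * 'I_m) * ('I_n * 'I_m)) : 'M[R]_(3, d) :=
  segment_differences (v p.1.1 p.1.2) (v p.1.1 p.1.2.+1)
    (v p.2.1 p.2.2) (v p.2.1 p.2.2.+1).
have cardJ : #|{: ('I_n * 'I_m) * ('I_n * 'I_m)}| = ((n * m) ^ 2)%N.
  by rewrite !card_prod !card_ord.
have [||A HA] := @segments_embedding R _ eps d k B e0 e1 _ k0.
- by rewrite cardJ expn_gt0 muln_gt0 n0 (ltnW m2).
- rewrite cardJ; apply: (@le_trans _ _ (X * eps ^+ 2)); last by rewrite ler_pM2r.
  rewrite XE; lra.
exists (dirac (A : borel_matrix R d k) : probability _ R), [set A]; split.
(* A singleton is closed in a Hausdorff space, hence Borel. *)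
- rewrite -[X in measurable X]setCK; apply: measurableC.
  apply: sub_sigma_algebra; apply: closed_openC.
  by apply: accessible_closed_set1; apply: hausdorff_accessible;
    exact: norm_hausdorff.
- by rewrite /= diracE mem_set// lee_fin gerBl powR_ge0.
move=> _ -> i j; apply: distances_preserved_pointwise => // s t s01 t01.
have [a [x [av -> ->]]] := on_segment A (T i) s01.
have [b [y [bv -> ->]]] := on_segment A (T j) t01.
have am : (a < m)%N := leq_trans (ltnW av) (Tm i).
have bm : (b < m)%N := leq_trans (ltnW bv) (Tm j).
rewrite -mulmxBl.
have [z ->] := segment_difference (v i a) (v i a.+1) (v j b) (v j b.+1) x y.
exact: (HA ((i, Ordinal am), (j, Ordinal bm)) z).
Qed.
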